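(* Let $H$ be a real Hilbert space, $\alpha,c,\tau>0$, and let $L:D(L)\subset H\to H$ be linear and m-accretive. On $D(L)\times H$ put $\tilde{\mathcal{B}}[\tilde U,V]^T=[\,L\tilde U+\alpha c\tilde U-\alpha\sqrt c\,V,\;-\alpha\sqrt c\,\tilde U+\alpha V\,]^T$. (1) Let $W^n=[U^n,V^n]^T$, set $\tilde W^n=[\sqrt c\,U^n,V^n]^T$, and suppose that the fully implicit scheme $$\frac1\tau(\tilde W^n-\tilde W^{n-1})+\tilde{\mathcal{B}}\tilde W^n=[\tilde F^n,0]^T,\qquad n\ge 1,$$ holds with $\tilde F^n=\sqrt c\,F^n$, $F^n\in H$. If $F^n=0$, then $$\|W^n\|_c\le\|W^{n-1}\|_c,\quad\text{equivalently}\quad \|\tilde W^n\|_{H\times H}\le\|\tilde W^{n-1}\|_{H\times H},$$ i.e. $(I+\tau\tilde{\mathcal{B}})^{-1}$ is a contraction (norm at most $1$) on $H\times H$. For general $F^n$, $$\|\tilde W^n\|_{H\times H}\le\|\tilde W^{n-1}\|_{H\times H}+\tau\|\tilde F^n\|_H .$$ (2) Let $H_h=\mathbb{R}^{N}$ with the Euclidean inner product, let $L_h:H_h\to H_h$ be a linear m-accretive operator, let $M_h$ be a symmetric positive definite $N\times N$ matrix, and let $\mathcal{M}_h=\begin{pmatrix}M_h&0\\0&M_h\end{pmatrix}$, $\mathcal{L}_h=\begin{pmatrix}L_h&0\\0&0\end{pmatrix}$, $\mathcal{C}=\alpha\begin{pmatrix}cI&-I\\-cI&I\end{pmatrix}$.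 If $W_h^n=[U_h^n,V_h^n]^T\in H_h\times H_h$ satisfies $$\frac1\tau\mathcal{M}_h(W_h^n-W_h^{n-1})+\mathcal{C}\mathcal{M}_hW_h^n+\mathcal{L}_hW_h^n=0,\qquad n\ge1,$$ then, with $\tilde W_h^n=[\sqrt c\,U_h^n,V_h^n]^T$, $$\|\mathcal{M}_h^{1/2}W_h^n\|_c\le\|\mathcal{M}_h^{1/2}W_h^{n-1}\|_c,\quad\text{equivalently}\quad \|\mathcal{M}_h^{1/2}\tilde W_h^n\|\le\|\mathcal{M}_h^{1/2}\tilde W_h^{n-1}\| .$$
   Context: A linear operator $L:D(L)\to H$ is accretive if $\langle LU,U\rangle\ge 0$ for all $U\in D(L)$, and m-accretive if in addition $I+L$ maps $D(L)$ onto $H$. The natural product norm is $\|[U,V]^T\|_{H\times H}^2=\|U\|_H^2+\|V\|_H^2$ and the weighted norm is $\|[U,V]^T\|_c^2=c\|U\|_H^2+\|V\|_H^2$; the same definitions are used on $H_h\times H_h$, where the unsubscripted norm is the natural (Euclidean) product norm. $\mathcal{M}_h^{1/2}$ is the symmetric positive definite square root of $\mathcal{M}_h$. The scheme in (1) is the symmetrized form of the implicit scheme $\frac{U^n-U^{n-1}}\tau-\alpha(V^n-cU^n)+LU^n=F^n$, $\frac{V^n-V^{n-1}}\tau+\alpha(V^n-cU^n)=0$. *)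

(* Defs.v *)
From mathcomp Require Export all_boot all_order all_algebra.
From mathcomp Require Export all_classical all_reals all_analysis.

Set Implicit Arguments.
Unset Strict Implicit.
Unset Printing Implicit Defensive.

Export Order.TTheory GRing.Theory Num.Theory.
Export numFieldNormedType.Exports.

Local Open Scope classical_set_scope.
Local Open Scope ring_scope.

(* A real Hilbert space is given as a complete normed space H together with a
   positive definite symmetric form dot : {dot H for idfun} that induces the
   norm of H. *)
Definition induces_norm (R : realType) (H : normedModType R)
    (dot : H -> H -> R) : Prop :=
  forall x, dot x x = `|x| ^+ 2.

(* An unbounded operator is a domain D together with a total function L whose
   values outside D are irrelevant. *)
Definition linear_operator (R : realType) (H : lmodType R)
    (D : set H) (L : H -> H) : Prop :=
  D 0 /\ forall (a : R) (x y : H), D x -> D y ->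
    D (a *: x + y) /\ L (a *: x + y) = a *: L x + L y.

(* The form dot is a parameter because the library norm on column vectors is
   the sup norm, whereas accretivity on R^N refers to the Euclidean product. *)
Definition accretive (R : realType) (H : lmodType R) (dot : H -> H -> R)
    (D : set H) (L : H -> H) : Prop :=
  forall u, D u -> 0 <= dot (L u) u.

Definition m_accretive (R : realType) (H : lmodType R) (dot : H -> H -> R)
    (D : set H) (L : H -> H) : Prop :=
  accretive dot D L /\ forall f : H, exists2 u, D u & u + L u = f.

(* The library norm on H * H is the maximum of the norms of the components,
   hence these two definitions. *)
Definition prod_norm (R : realType) (H : Type) (nrm : H -> R)
    (w : H * H) : R :=
  Num.sqrt (nrm w.1 ^+ 2 + nrm w.2 ^+ 2).

Definition weighted_norm (R : realType) (H : Type) (nrm : H -> R) (c : R)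
    (w : H * H) : R :=
  Num.sqrt (c * nrm w.1 ^+ 2 + nrm w.2 ^+ 2).

Definition tilde (R : realType) (H : lmodType R) (c : R) (w : H * H) : H * H :=
  (Num.sqrt c *: w.1, w.2).

Definition Btilde (R : realType) (H : lmodType R) (alpha c : R) (L : H -> H)
    (w : H * H) : H * H :=
  (L w.1 + (alpha * c) *: w.1 - (alpha * Num.sqrt c) *: w.2,
   - ((alpha * Num.sqrt c) *: w.1) + alpha *: w.2).

(* J is the everywhere defined two-sided inverse of the operator A with
   domain D. *)
Definition is_inverse_of (X : Type) (J : X -> X) (D : set X) (A : X -> X) :
    Prop :=
  (forall f, D (J f) /\ A (J f) = f) /\ (forall w, D w -> J (A w) = w).

Definition eucl_dot (R : realType) (n : nat) (u v : 'cV[R]_n) : R :=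
  \sum_(i < n) u i 0 * v i 0.

Definition eucl_norm (R : realType) (n : nat) (u : 'cV[R]_n) : R :=
  Num.sqrt (eucl_dot u u).

Definition sym_posdef (R : realType) (n : nat) (A : 'M[R]_n) : Prop :=
  A^T = A /\ forall x : 'cV[R]_n, x != 0 -> 0 < eucl_dot (A *m x) x.

Definition is_spd_sqrt (R : realType) (n : nat) (S A : 'M[R]_n) : Prop :=
  sym_posdef S /\ S *m S = A.

(* Column vectors of height N + N represent elements of R^N x R^N. *)
Definition components (R : realType) (N : nat) (w : 'cV[R]_(N + N)) :
    'cV[R]_N * 'cV[R]_N :=
  (usubmx w, dsubmx w).

Definition tilde_h (R : realType) (N : nat) (c : R) (w : 'cV[R]_(N + N)) :
    'cV[R]_(N + N) :=
  col_mx (Num.sqrt c *: usubmx w) (dsubmx w).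

Definition calM (R : realType) (N : nat) (M : 'M[R]_N) : 'M[R]_(N + N) :=
  block_mx M 0 0 M.

Definition calL (R : realType) (N : nat) (L : 'M[R]_N) : 'M[R]_(N + N) :=
  block_mx L 0 0 0.

Definition calC (R : realType) (N : nat) (alpha c : R) : 'M[R]_(N + N) :=
  alpha *: block_mx c%:M (- 1%:M) (- c%:M) 1%:M.

(* Main.v *)
From HB Require Import structures.
Require Import Defs.
From mathcomp Require Import ring lra.
Set Implicit Arguments.
Unset Strict Implicit.
Unset Printing Implicit Defensive.

Local Open Scope classical_set_scope.
Local Open Scope ring_scope.

(** Both halves of the theorem rest on one remark: if [a] is a positive
semidefinite symmetric form and [0 <= a x y], then
[a x x <= a (x + y) (x + y)]. An implicit step has the shape
[w + tau B w = w'], so it does not increase the [a]-energy as soon as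
[a w (B w) >= 0].

On [H * H] take the natural product form and the symmetrized operator
[Btilde]. With [s = sqrt c], its energy is
[<L u, u> + alpha * |s u - v|^2 >= 0] ([Btilde_accretive]). This gives the
contraction estimate, the injectivity of [I + tau B], and, after moving the
source to the right-hand side and using the triangle inequality, the estimate
for general [F].

The resolvent also has to be everywhere defined. Eliminating [v] from
[w + tau B w = (f, g)] leaves one equation [k u + L u = f'] with [k > 0]
([Btilde_step_onto]), whereas m-accretivity solves it only for [k = 1].
Accretivity bounds the inverse of [k + L] by [1 / k], so solvability at [k]
passes to every [l] with [|k - l| < k] by the Banach fixed point theorem
([shift_onto_near]), and hence, going up by steps of one half and down in one
step, to all [l > 0] ([m_accretive_shift_onto]).

In the discrete case let [T = diag (sqrt c, 1)], [M2 = diag (M, M)] and let [S]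
be the square root of [M2]. Then the [c]-norm of [S w] is [|T S w|]. The root
[S] is only known as a symmetric positive definite matrix with [S S = M2], so
its commutation with [T] has to be proved: it follows from the uniqueness of
the solution of [S X + X S = 0] ([commute_posdef_sqrt]). Hence
[|T S w| = |S T w|], which is the stated equivalence, and the energy form
[<S T x, S T y>] equals [<T T x, M2 y>]. Testing the scheme with
[T T w = (c u, v)] gives the dissipation
[c <L u, u> + alpha <M (c u - v), c u - v> >= 0] ([semidiscrete_accretive]). *)

(** * Positive semidefinite symmetric forms *)

(** A predicate on plain functions, so that one set of rules covers the scalar
product of a Hilbert space, its product form and the Euclidean product. *)
Definition psd_form (R : realType) (V : lmodType R) (a : V -> V -> R) : Prop :=
  [/\ forall k x y z, a (k *: x + y) z = k * a x z + a y z,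
      forall x y, a x y = a y x
    & forall x, 0 <= a x x].

Lemma psd_formDl (R : realType) (V : lmodType R) (a : V -> V -> R) x y z :
  psd_form a -> a (x + y) z = a x z + a y z.
Proof. by case=> aP _ _; rewrite -[x in x + _]scale1r aP mul1r. Qed.

Lemma psd_form0l (R : realType) (V : lmodType R) (a : V -> V -> R) z :
  psd_form a -> a 0 z = 0.
Proof.
by move=> aP; apply: (addrI (a 0 z)); rewrite -psd_formDl// !addr0.
Qed.

Lemma psd_formZl (R : realType) (V : lmodType R) (a : V -> V -> R) k x z :
  psd_form a -> a (k *: x) z = k * a x z.
Proof.
by move=> aP; case: (aP) => lin _ _; rewrite -[k *: x]addr0 lin psd_form0l//
  addr0.
Qed.

Lemma psd_formDr (R : realType) (V : lmodType R) (a : V -> V -> R) x y z :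
  psd_form a -> a z (x + y) = a z x + a z y.
Proof.
by move=> aP; case: (aP) => _ aC _; rewrite aC psd_formDl// !(aC _ z).
Qed.

Lemma psd_formZr (R : realType) (V : lmodType R) (a : V -> V -> R) k x z :
  psd_form a -> a z (k *: x) = k * a z x.
Proof.
by move=> aP; case: (aP) => _ aC _; rewrite aC psd_formZl// aC.
Qed.

Lemma psd_formNl (R : realType) (V : lmodType R) (a : V -> V -> R) x z :
  psd_form a -> a (- x) z = - a x z.
Proof. by move=> aP; rewrite -scaleN1r psd_formZl// mulN1r. Qed.

Lemma psd_formNr (R : realType) (V : lmodType R) (a : V -> V -> R) x z :
  psd_form a -> a z (- x) = - a z x.
Proof. by move=> aP; rewrite -scaleN1r psd_formZr// mulN1r. Qed.

Definition psd_formE (R : realType) (V : lmodType R) (a : V -> V -> R)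
    (aP : psd_form a) :=
  (fun x z => psd_formNl x z aP, fun x z => psd_formNr x z aP,
   fun x y z => psd_formDl x y z aP, fun x y z => psd_formDr x y z aP,
   fun k x z => psd_formZl k x z aP, fun k x z => psd_formZr k x z aP).

(** The difference of the two sides is [2 a x y + a y y]. *)
Lemma le_psd_formD (R : realType) (V : lmodType R) (a : V -> V -> R) x y :
  psd_form a -> 0 <= a x y -> a x x <= a (x + y) (x + y).
Proof.
move=> aP axy; case: (aP) => _ aC a_ge0; have := a_ge0 y.
rewrite !(psd_formE aP) (aC y x); lra.
Qed.

Lemma dot_psd_form (R : realType) (H : normedModType R)
    (dot : {dot H for idfun}) :
  induces_norm dot -> psd_form dot.
Proof.
move=> dotE; split=> [k x y z|x y|x].
- by rewrite linearDl linearZl_LR.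
- by rewrite hermC/= expr0 mul1r.
- by rewrite dotE exprn_ge0.
Qed.

(** * The symmetrized operator *)

Definition pair_dot (R : realType) (V : lmodType R) (a : V -> V -> R)
    (w z : V * V) : R := a w.1 z.1 + a w.2 z.2.

Lemma pair_dot_psd_form (R : realType) (V : lmodType R) (a : V -> V -> R) :
  psd_form a -> psd_form (pair_dot a).
Proof.
move=> aP; case: (aP) => lin aC a_ge0; split=> [k x y z|x y|x].
- rewrite /pair_dot/= !lin; ring.
- by rewrite /pair_dot aC (aC x.2).
- by rewrite addr_ge0.
Qed.

(** The coupling terms form a perfect square:
[alpha * (c |u|^2 - 2 s <u, v> + |v|^2) = alpha * |s u - v|^2] for
[s = sqrt c]. *)
Lemma Btilde_accretive (R : realType) (V : lmodType R) (a : V -> V -> R)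
    (alpha c : R) (D : set V) (L : V -> V) :
  psd_form a -> 0 <= alpha -> 0 <= c -> accretive a D L ->
  accretive (pair_dot a) [set w | D w.1] (Btilde alpha c L).
Proof.
move=> aP alpha_ge0 c_ge0 Lacc [u v] /= Du.
case: (aP) => _ aC a_ge0; set s := Num.sqrt c.
suff -> : pair_dot a (Btilde alpha c L (u, v)) (u, v) =
    a (L u) u + alpha * a (s *: u - v) (s *: u - v).
  by rewrite addr_ge0 ?Lacc// mulr_ge0.
rewrite /pair_dot /Btilde/= -/s !(psd_formE aP) (aC v u).
rewrite -[c in alpha * c](sqr_sqrtr c_ge0) -/s; ring.
Qed.

(** * Inverses and resolvents of linear operators *)

(** The inverse is obtained by choosing preimages; injectivity of [A] on [D]
makes the choice linear. *)
Lemma linear_operator_inverse (R : realType) (X : lmodType R) (D : set X)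
    (A : X -> X) :
  linear_operator D A -> (forall w, D w -> A w = 0 -> w = 0) ->
  (forall f, exists2 w, D w & A w = f) ->
  exists J : {linear X -> X}, is_inverse_of J D A.
Proof.
move=> [D0 DA] Ainj Asurj.
have inj w z : D w -> D z -> A w = A z -> w = z.
  move=> Dw Dz Awz; apply/subr0_eq; have [Dzw Azw] := DA (-1) z w Dz Dw.
  rewrite addrC -scaleN1r; apply: Ainj => //.
  by rewrite Azw Awz scaleN1r addNr.
have /(_ _)/cid2 J_ := Asurj.
pose J f := projT1 (J_ f).
have DJ f : D (J f) by rewrite /J; case: (J_ f).
have AJ f : A (J f) = f by rewrite /J; case: (J_ f).
have Jlin : linear J.
  move=> k f g; have [DJfg AJfg] := DA k _ _ (DJ f) (DJ g).
  by apply: inj => //; rewrite AJfg !AJ.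
pose Jm := GRing.isLinear.Build R X X _ J Jlin.
pose Jl : {linear X -> X} := HB.pack J Jm.
by exists Jl; split=> [f|w Dw]; [split|apply: inj].
Qed.

Definition shift_onto (R : realType) (V : lmodType R) (D : set V) (L : V -> V)
    (k : R) : Prop :=
  forall f, exists2 u, D u & k *: u + L u = f.

(** Accretivity makes the pairing of [k u] with [L u] nonnegative, so adding
[L u] cannot shorten [k u]: the inverse of [k + L] is bounded by [1 / k]. *)
Lemma le_norm_shift (R : realType) (H : normedModType R)
    (dot : {dot H for idfun}) (D : set H) (L : H -> H) (k : R) (u : H) :
  induces_norm dot -> accretive dot D L -> 0 <= k -> D u ->
  k * `|u| <= `|k *: u + L u|.
Proof.
move=> dotE Lacc k_ge0 Du; have dotP := dot_psd_form dotE.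
rewrite -[X in X * _](ger0_norm k_ge0) -normrZ -ler_sqr ?nnegrE// -!dotE.
apply: le_psd_formD => //; case: (dotP) => _ dotC _.
by rewrite psd_formZl// mulr_ge0// dotC Lacc.
Qed.

(** The equation [l u + L u = f] reads [u = G (f + (k - l) u)], with [G] the
inverse of [k + L]; this is a contraction of ratio [|k - l| / k]. Completeness
of [H] enters the proof here only. *)
Lemma shift_onto_near (R : realType) (H : completeNormedModType R)
    (dot : {dot H for idfun}) (D : set H) (L : H -> H) (k l : R) :
  induces_norm dot -> linear_operator D L -> accretive dot D L ->
  0 < k -> `|k - l| < k -> shift_onto D L k -> shift_onto D L l.
Proof.
move=> dotE [_ Llin] Lacc k_gt0 klk Lk f.
have /(_ _)/cid2 G_ := Lk.
pose G g := projT1 (G_ g).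
have DG g : D (G g) by rewrite /G; case: (G_ g).
have LG g : k *: G g + L (G g) = g by rewrite /G; case: (G_ g).
pose T u := G (f + (k - l) *: u).
have T_lip u v : `|T u - T v| <= `|k - l| / k * `|u - v|.
  have [DTuv LTuv] :=
    Llin (-1) _ _ (DG (f + (k - l) *: v)) (DG (f + (k - l) *: u)).
  rewrite scaleN1r addrC in DTuv; rewrite !scaleN1r !(addrC (- _)) in LTuv.
  rewrite mulrAC ler_pdivlMr// mulrC.
  rewrite (le_trans (le_norm_shift dotE Lacc (ltW k_gt0) DTuv))//.
  rewrite LTuv scalerBr addrACA -opprD !LG opprD addrACA subrr add0r.
  by rewrite -scalerBr normrZ.
have q_ge0 : 0 <= `|k - l| / k by rewrite divr_ge0// ltW.
pose q : {nonneg R} := NngNum q_ge0.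
pose Tm := isFun.Build H H setT setT T (fun _ _ => I).
pose Tf : {fun setT >-> setT} := HB.pack T Tm.
have [||u _ uE] := @banach_fixed_point R H setT Tf _ closedT.
- exists q; split=> /=; first by rewrite ltr_pdivrMr// mul1r.
  by move=> [x y] _ /=; exact: T_lip.
- by exists 0.
exists u; first by rewrite uE; exact: DG.
have := LG (f + (k - l) *: u); rewrite -/(T u) -[T u]uE => ku.
by apply: (addIr ((k - l) *: u)); rewrite -ku addrAC -scalerDl (addrC l) subrK.
Qed.

(** Solvability at [1] is carried to [1 + n / 2] by steps of [1 / 2], which are
always shorter than the current shift, and from a shift larger than [k] down to
[k] in a single step. *)
Lemma m_accretive_shift_onto (R : realType) (H : completeNormedModType R)
    (dot : {dot H for idfun}) (D : set H) (L : H -> H) (k : R) :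
  induces_norm dot -> linear_operator D L -> m_accretive dot D L ->
  0 < k -> shift_onto D L k.
Proof.
move=> dotE Llin [Lacc L1] k_gt0.
have near := shift_onto_near dotE Llin Lacc.
have half n : shift_onto D L (1 + n%:R / 2).
  elim: n => [|n IHn].
    by move=> f; have [u Du <-] := L1 f; exists u;
      rewrite // mul0r addr0 scale1r.
  have n_ge0 : 0 <= n%:R :> R by [].
  apply: near IHn; first by lra.
  by rewrite -[n.+1%:R]natr1 ltr_norml; apply/andP; split; lra.
have [n kn] : exists n : nat, k < 1 + n%:R / 2.
  (* The factor two compensates for the half steps. *)
  exists (Num.bound k * 2)%N.
  rewrite natrM mulfK ?pnatr_eq0//.
  have := archi_boundP (ltW k_gt0); lra.
apply: near (half n); first by lra.
by rewrite ltr_norml; apply/andP; split; lra.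
Qed.

(** * One implicit step in the Hilbert space *)

Lemma Btilde_step_linear (R : realType) (V : lmodType R) (alpha c tau : R)
    (D : set V) (L : V -> V) :
  linear_operator D L ->
  linear_operator [set w : V * V | D w.1]
    (fun w => w + tau *: Btilde alpha c L w).
Proof.
move=> [D0 Llin]; split=> // k [u v] [u' v'] /= Du Du'.
have [Duu' Luu'] := Llin k u u' Du Du'; split=> //.
have lin2 (a b : R) (x y x' y' : V) : a *: (k *: x + x') + b *: (k *: y + y') =
    k *: (a *: x + b *: y) + (a *: x' + b *: y').
  rewrite !scalerDr !scalerA !(mulrC k) !addrA; congr (_ + _).
  by rewrite addrAC.
have lin1 (b : R) (x y x' y' : V) : (k *: x + x') + b *: (k *: y + y') =
    k *: (x + b *: y) + (x' + b *: y').
  by have := lin2 1 b x y x' y'; rewrite !scale1r.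
rewrite /Btilde/= -!scaleNr; congr pair => /=.
- by rewrite Luu' !lin1.
- by rewrite lin2 lin1.
Qed.

(** Eliminating [v = (g + tau alpha s u) / d], with [d = 1 + tau alpha] and
[s = sqrt c], from the second equation turns the first one, divided by [tau],
into [(tau^-1 + alpha c / d) u + L u = tau^-1 f + (alpha s / d) g], whose shift
is positive. *)
Lemma Btilde_step_onto (R : realType) (V : lmodType R) (alpha c tau : R)
    (D : set V) (L : V -> V) :
  0 < alpha -> 0 < c -> 0 < tau ->
  (forall k, 0 < k -> shift_onto D L k) ->
  forall f : V * V, exists2 w : V * V, D w.1 &
    w + tau *: Btilde alpha c L w = f.
Proof.
move=> alpha_gt0 c_gt0 tau_gt0 Lk [f g]; set s := Num.sqrt c.
have ss : s * s = c by rewrite -expr2 sqr_sqrtr// ltW.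
pose d := 1 + tau * alpha.
have d_gt0 : 0 < d by rewrite addr_gt0// mulr_gt0.
have k_gt0 : 0 < tau^-1 + alpha * c / d.
  by rewrite addr_gt0 ?invr_gt0// divr_gt0// mulr_gt0.
have [u Du uE] := Lk _ k_gt0 (tau^-1 *: f + (alpha * s / d) *: g).
pose v := d^-1 *: (g + (tau * alpha * s) *: u).
exists (u, v) => //=.
have dE : d != 0 by rewrite gt_eqF.
have tE : tau != 0 by rewrite gt_eqF.
have gE : g = d *: v - (tau * alpha * s) *: u.
  by rewrite scalerA mulfV// scale1r addrK.
have fE : f = tau *: ((tau^-1 + alpha * c) *: u + L u - (alpha * s) *: v).
  apply: (scalerI (invr_neq0 tE)); rewrite [RHS]scalerA mulVf// scale1r.
  apply: (addIr ((alpha * s / d) *: g)); rewrite -uE.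
  rewrite [in RHS]gE scalerBr !scalerA divfK// addrA subrK addrAC -scalerBl.
  by congr (_ *: u + L u); rewrite -ss /d; field; rewrite -/d dE tE.
rewrite /Btilde/= -/s; congr pair => /=.
- rewrite fE [in RHS]scalerDl -!addrA [in RHS]scalerDr [in RHS]scalerA mulfV//.
  by rewrite scale1r (addrCA (L u)).
- rewrite gE /d scalerDl scale1r scalerDr scalerN !scalerA -addrA mulrA.
  by rewrite (addrC (- _)).
Qed.

Lemma prod_norm_tilde (R : realType) (H : normedModType R) (c : R) (w : H * H) :
  0 <= c ->
  prod_norm (fun x : H => `|x|) (tilde c w) =
  weighted_norm (fun x : H => `|x|) c w.
Proof.
move=> c_ge0; rewrite /prod_norm /weighted_norm/= normrZ exprMn.
by rewrite ger0_norm ?sqrtr_ge0// sqr_sqrtr.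
Qed.

(** In the form [|w| <= |(I + tau B) w|], the contraction estimate gives at once
the injectivity of [I + tau B], the bound on its inverse and both estimates for
the scheme. *)
Lemma le_prod_norm_step (R : realType) (H : normedModType R)
    (dot : {dot H for idfun}) (D : set H) (L : H -> H) (alpha c tau : R)
    (w : H * H) :
  0 <= alpha -> 0 <= c -> 0 <= tau ->
  induces_norm dot -> accretive dot D L -> D w.1 ->
  prod_norm (fun x : H => `|x|) w <=
  prod_norm (fun x : H => `|x|) (w + tau *: Btilde alpha c L w).
Proof.
move=> alpha_ge0 c_ge0 tau_ge0 dotE Lacc Dw.
have dotP := pair_dot_psd_form (dot_psd_form dotE).
have prod_normE z :
    prod_norm (fun x : H => `|x|) z = Num.sqrt (pair_dot dot z z).
  by rewrite /prod_norm /pair_dot !dotE.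
rewrite !prod_normE ler_wsqrtr// le_psd_formD//.
case: (dotP) => _ dotC _; rewrite psd_formZr// dotC mulr_ge0//.
exact: (Btilde_accretive (dot_psd_form dotE) alpha_ge0 c_ge0 Lacc).
Qed.

(** This is the form of the triangle inequality for a source that acts on the
first component only. With [|u + x| <= |u| + |x|], the squared inequality
reduces to [|u| <= sqrt (|u|^2 + |v|^2)]. *)
Lemma prod_normD_left (R : realType) (H : normedModType R) (w : H * H) (x : H) :
  prod_norm (fun y : H => `|y|) (w + (x, 0)) <=
  prod_norm (fun y : H => `|y|) w + `|x|.
Proof.
case: w => u v; rewrite /prod_norm/= addr0.
set p := `|u|; set q := `|v|; set r := `|x|.
have [p_ge0 r_ge0] : 0 <= p /\ 0 <= r by rewrite !normr_ge0.
have s_ge0 : 0 <= p ^+ 2 + q ^+ 2 by rewrite addr_ge0 ?sqr_ge0.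
have ps : p <= Num.sqrt (p ^+ 2 + q ^+ 2).
  by rewrite -[leLHS](ger0_norm p_ge0) -sqrtr_sqr ler_wsqrtr// lerDl sqr_ge0.
have uxle : `|u + x| ^+ 2 <= (p + r) ^+ 2.
  by rewrite ler_sqr ?nnegrE ?addr_ge0// ler_normD.
rewrite -[leRHS]ger0_norm ?addr_ge0 ?sqrtr_ge0// -sqrtr_sqr ler_wsqrtr//.
rewrite sqrrD sqr_sqrtr//; rewrite sqrrD in uxle.
have : p * r <= Num.sqrt (p ^+ 2 + q ^+ 2) * r by rewrite ler_wpM2r.
lra.
Qed.

(** * Euclidean product and positive definite matrices *)

Lemma eucl_dotE (R : realType) (n : nat) (u v : 'cV[R]_n) :
  eucl_dot u v = (u^T *m v) 0 0.
Proof. by rewrite mxE; apply: eq_bigr => i _; rewrite mxE. Qed.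

Lemma eucl_dot_psd_form (R : realType) (n : nat) : psd_form (@eucl_dot R n).
Proof.
split=> [k x y z|x y|x].
- by rewrite !eucl_dotE linearP/= mulmxDl -scalemxAl !mxE.
- by apply: eq_bigr => i _; rewrite mulrC.
- by apply: sumr_ge0 => i _; rewrite -expr2 sqr_ge0.
Qed.

Lemma eucl_dot_mull (R : realType) (m n : nat) (A : 'M[R]_(m, n)) u v :
  eucl_dot (A *m u) v = eucl_dot u (A^T *m v).
Proof. by rewrite !eucl_dotE trmx_mul mulmxA. Qed.

Lemma eucl_dot_col_mx (R : realType) (m n : nat) (u u' : 'cV[R]_m)
    (v v' : 'cV[R]_n) :
  eucl_dot (col_mx u v) (col_mx u' v') = eucl_dot u u' + eucl_dot v v'.
Proof. by rewrite !eucl_dotE tr_col_mx mul_row_col mxE. Qed.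

Lemma sym_posdef_ge0 (R : realType) (n : nat) (A : 'M[R]_n) (x : 'cV[R]_n) :
  sym_posdef A -> 0 <= eucl_dot (A *m x) x.
Proof.
move=> [_ Apos]; have [->|/Apos/ltW//] := eqVneq x 0.
by rewrite mulmx0 psd_form0l//; apply: eucl_dot_psd_form.
Qed.

Lemma mxtrace_trmx_mul (R : realType) (m n : nat) (X Y : 'M[R]_(n, m)) :
  \tr (X^T *m Y) = \sum_j eucl_dot (col j X) (col j Y).
Proof.
by apply: eq_bigr => j _; rewrite mxE; apply: eq_bigr => i _; rewrite !mxE.
Qed.

(** Taking the Frobenius product of the equation with [X] gives
[tr (X^T S X) + tr (X S X^T) = 0]. Both traces are sums of values of the
positive definite form of [S], at the columns of [X] and of [X^T], so every
column of [X] vanishes. *)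
Lemma posdef_sylvester (R : realType) (n : nat) (S X : 'M[R]_n) :
  sym_posdef S -> S *m X + X *m S = 0 -> X = 0.
Proof.
move=> Spd SX; have [_ Spos] := Spd.
have tr_ge0 (Y : 'M[R]_n) j : 0 <= eucl_dot (col j Y) (col j (S *m Y)).
  rewrite !(colE _ (S *m _), mulmxA) -mulmxA -colE.
  case: (eucl_dot_psd_form R n) => _ -> _.
  exact: sym_posdef_ge0.
have sum0 : \sum_j eucl_dot (col j X) (col j (S *m X))
    + \sum_j eucl_dot (col j X^T) (col j (S *m X^T)) = 0.
  rewrite -!mxtrace_trmx_mul trmxK (mulmxA X) (mxtrace_mulC (X *m S)).
  by rewrite -mxtraceD -mulmxDr SX mulmx0 mxtrace0.
have {}sum0 : \sum_j eucl_dot (col j X) (col j (S *m X)) = 0.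
  apply/eqP.
  by rewrite eq_le sumr_ge0 ?andbT -?[leRHS]sum0 ?lerDl ?sumr_ge0.
apply/matrixP => i j; rewrite mxE.
have := psumr_eq0P (fun j _ => tr_ge0 X j) sum0 (i := j) isT.
have [Xj0 _|Xj_neq0] := eqVneq (col j X) 0.
  by move/matrixP/(_ i 0): Xj0; rewrite !mxE.
have := Spos _ Xj_neq0; case: (eucl_dot_psd_form R n) => _ -> _.
by rewrite !colE -mulmxA => /[swap] ->; rewrite ltxx.
Qed.

(** If [T] commutes with [S S], the commutator [X = T S - S T] satisfies
[S X + X S = 0]. *)
Lemma commute_posdef_sqrt (R : realType) (n : nat) (S T : 'M[R]_n) :
  sym_posdef S -> T *m (S *m S) = S *m S *m T -> T *m S = S *m T.
Proof.
move=> Spd TSS; apply/subr0_eq/(posdef_sylvester Spd).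
by rewrite mulmxBr mulmxBl !mulmxA -(mulmxA T) TSS addrC addrA subrK subrr.
Qed.

(** * One implicit step of the discrete scheme *)

Lemma tilde_hE (R : realType) (N : nat) (c : R) (w : 'cV[R]_(N + N)) :
  tilde_h c w = block_mx (Num.sqrt c)%:M 0 0 1%:M *m w.
Proof.
rewrite -[in RHS](vsubmxK w) mul_block_col !mul0mx addr0 add0r.
by rewrite mul1mx mul_scalar_mx.
Qed.

Lemma prod_norm_components (R : realType) (N : nat) (w : 'cV[R]_(N + N)) :
  prod_norm (@eucl_norm R N) (components w) = Num.sqrt (eucl_dot w w).
Proof.
have [_ _ dot_ge0] := eucl_dot_psd_form R N.
rewrite /prod_norm /eucl_norm !sqr_sqrtr// -eucl_dot_col_mx.
by rewrite vsubmxK.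
Qed.

Lemma weighted_norm_components (R : realType) (N : nat) (c : R)
    (w : 'cV[R]_(N + N)) :
  0 <= c ->
  weighted_norm (@eucl_norm R N) c (components w) =
  prod_norm (@eucl_norm R N) (components (tilde_h c w)).
Proof.
move=> c_ge0; have aP := eucl_dot_psd_form R N; have [_ _ dot_ge0] := aP.
rewrite /weighted_norm /prod_norm /eucl_norm !sqr_sqrtr//=.
rewrite col_mxKu col_mxKd (psd_formZl _ _ _ aP) (psd_formZr _ _ _ aP).
by rewrite mulrA -expr2 sqr_sqrtr.
Qed.

(** Testing with [(c u, v)] rather than [(u, v)] symmetrizes the coupling: the
pairing equals [c <L u, u> + alpha <M (c u - v), c u - v>]. *)
Lemma semidiscrete_accretive (R : realType) (N : nat) (alpha c : R)
    (L M : 'M[R]_N) (w : 'cV[R]_(N + N)) :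
  0 <= alpha -> 0 <= c -> sym_posdef M ->
  accretive (@eucl_dot R N) setT (fun u : 'cV[R]_N => L *m u) ->
  0 <= eucl_dot (block_mx c%:M 0 0 1%:M *m w)
         (calC N alpha c *m calM M *m w + calL L *m w).
Proof.
move=> alpha_ge0 c_ge0 Mpd Lacc; rewrite -(vsubmxK w).
set u := usubmx w; set v := dsubmx w.
have aP := eucl_dot_psd_form R N; have [_ aC _] := aP.
suff -> : eucl_dot (block_mx c%:M 0 0 1%:M *m col_mx u v)
    (calC N alpha c *m calM M *m col_mx u v + calL L *m col_mx u v) =
    c * eucl_dot (L *m u) u +
    alpha * eucl_dot (M *m (c *: u - v)) (c *: u - v).
  by rewrite addr_ge0 ?mulr_ge0 ?Lacc ?sym_posdef_ge0.
rewrite -mulmxA /calC /calM /calL !mul_block_col -scalemxAl mul_block_col.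
rewrite !mul0mx !mulNmx !mul1mx !mul_scalar_mx ?addr0 ?add0r scale_col_mx.
rewrite add_col_mx eucl_dot_col_mx addr0.
rewrite mulmxBr -scalemxAr !(psd_formE aP) (aC u (L *m u)) !(aC u (M *m _)).
by rewrite !(aC v (M *m _)); ring.
Qed.

(** The energy [|S T w|^2] is the form [<D w, calM w>] with
[D = diag (c, 1) = T T]: moving [S] and [T] to one side gives
[T calM T = calM D], whatever the block structure of [S]. The scheme identifies
[calM (w' - w)] with [tau] times the vector of [semidiscrete_accretive]. *)
Lemma le_semidiscrete_step (R : realType) (N : nat) (alpha c tau : R)
    (L M : 'M[R]_N) (S : 'M[R]_(N + N)) (w w' : 'cV[R]_(N + N)) :
  0 <= alpha -> 0 <= c -> 0 < tau -> sym_posdef M ->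
  accretive (@eucl_dot R N) setT (fun u : 'cV[R]_N => L *m u) ->
  is_spd_sqrt S (calM M) ->
  tau^-1 *: (calM M *m (w - w'))
    + calC N alpha c *m calM M *m w + calL L *m w = 0 ->
  eucl_dot (S *m tilde_h c w) (S *m tilde_h c w) <=
  eucl_dot (S *m tilde_h c w') (S *m tilde_h c w').
Proof.
move=> alpha_ge0 c_ge0 tau_gt0 Mpd Lacc [[St _] SS] scheme.
have aP := eucl_dot_psd_form R (N + N); have [_ aC _] := aP.
have tauE : tau != 0 by rewrite gt_eqF.
pose g := calC N alpha c *m calM M *m w + calL L *m w.
have gE : calM M *m (w' - w) = tau *: g.
  apply: (scalerI (invr_neq0 tauE)); rewrite scalerA mulVf// scale1r.
  rewrite -opprB mulmxN scalerN; apply/esym/eqP.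
  by rewrite -addr_eq0 addrC /g addrA scheme.
have -> : w' = w + (w' - w) by rewrite addrC subrK.
move: (w' - w) gE => d gE.
rewrite !tilde_hE !mulmxDr; apply: le_psd_formD => //.
set T := block_mx _ _ _ _.
have TT : T *m calM M *m T = calM M *m block_mx c%:M 0 0 1%:M.
  rewrite /T /calM !mulmx_block !(mulmx0, mul0mx, addr0, add0r, mul1mx, mulmx1).
  rewrite mul_scalar_mx -scalemxAl mul_mx_scalar scalerA -expr2 sqr_sqrtr//.
  by rewrite mul_mx_scalar.
have Tt : T^T = T by rewrite /T tr_block_mx !trmx0 !tr_scalar_mx.
have -> : eucl_dot (S *m (T *m w)) (S *m (T *m d)) =
    tau * eucl_dot (block_mx c%:M 0 0 1%:M *m w) g.
  rewrite eucl_dot_mull St mulmxA SS [LHS]eucl_dot_mull Tt !mulmxA TT.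
  have Mt : (calM M)^T = calM M by rewrite -SS trmx_mul St.
  have Dt : (block_mx c%:M 0 0 1%:M : 'M[R]_(N + N))^T = block_mx c%:M 0 0 1%:M.
    by rewrite tr_block_mx !trmx0 !tr_scalar_mx.
  have MD : calM M *m block_mx c%:M 0 0 1%:M = block_mx c%:M 0 0 1%:M *m calM M.
    by have := congr1 trmx TT; rewrite !trmx_mul Tt Mt Dt mulmxA TT.
  by rewrite MD -mulmxA gE eucl_dot_mull Dt -scalemxAr (psd_formZr _ _ _ aP).
by apply: mulr_ge0; [exact: ltW|exact: semidiscrete_accretive].
Qed.

Theorem lemma1 (R : realType) (alpha c tau : R)
  (alpha_gt0 : 0 < alpha) (c_gt0 : 0 < c) (tau_gt0 : 0 < tau) :
  (* (1) *)
  (forall (H : completeNormedModType R) (dot : {dot H for idfun})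
      (D : set H) (L : H -> H),
    induces_norm dot -> linear_operator D L -> m_accretive dot D L ->
    let hnorm := fun x : H => `|x| in
    let B := Btilde alpha c L in
    [/\ (forall W W' : H * H,
          weighted_norm hnorm c W <= weighted_norm hnorm c W' <->
          prod_norm hnorm (tilde c W) <= prod_norm hnorm (tilde c W')),
        (exists J : {linear (H * H)%type -> (H * H)%type},
          is_inverse_of J [set w | D w.1] (fun w => w + tau *: B w) /\
          forall f : H * H, prod_norm hnorm (J f) <= prod_norm hnorm f)
      & forall (W : nat -> H * H) (F : nat -> H),
        let Wt := fun n => tilde c (W n) in
        let Ft := fun n => Num.sqrt c *: F n in
        (forall n, (1 <= n)%N ->
          D (Wt n).1 /\
          tau^-1 *: (Wt n - Wt n.-1) + B (Wt n) = (Ft n, 0)) ->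
        forall n, (1 <= n)%N ->
          (F n = 0 ->
            weighted_norm hnorm c (W n) <= weighted_norm hnorm c (W n.-1) /\
            prod_norm hnorm (Wt n) <= prod_norm hnorm (Wt n.-1)) /\
          prod_norm hnorm (Wt n) <=
            prod_norm hnorm (Wt n.-1) + tau * hnorm (Ft n)])
  /\
  (* (2) *)
  (forall (N : nat) (Lh Mh : 'M[R]_N) (sqrtM : 'M[R]_(N + N)),
    m_accretive (@eucl_dot R N) setT (fun u : 'cV[R]_N => Lh *m u) ->
    sym_posdef Mh ->
    is_spd_sqrt sqrtM (calM Mh) ->
    let cnorm := fun w : 'cV[R]_(N + N) =>
      weighted_norm (@eucl_norm R N) c (components w) in
    let pnorm := fun w : 'cV[R]_(N + N) =>
      prod_norm (@eucl_norm R N) (components w) in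
    (forall W W' : 'cV[R]_(N + N),
      cnorm (sqrtM *m W) <= cnorm (sqrtM *m W') <->
      pnorm (sqrtM *m tilde_h c W) <= pnorm (sqrtM *m tilde_h c W')) /\
    forall W : nat -> 'cV[R]_(N + N),
      (forall n, (1 <= n)%N ->
        tau^-1 *: (calM Mh *m (W n - W n.-1))
        + calC N alpha c *m calM Mh *m W n + calL Lh *m W n = 0) ->
      forall n, (1 <= n)%N ->
        cnorm (sqrtM *m W n) <= cnorm (sqrtM *m W n.-1) /\
        pnorm (sqrtM *m tilde_h c (W n)) <=
          pnorm (sqrtM *m tilde_h c (W n.-1))).
Proof.
split.
- move=> H dot D L dotE Llin Lmacc hnorm B; have [Lacc _] := Lmacc.
  have tildeE := prod_norm_tilde _ (ltW c_gt0).
  have expansive w : D w.1 ->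
      prod_norm hnorm w <= prod_norm hnorm (w + tau *: B w).
    by apply: le_prod_norm_step dotE Lacc; exact: ltW.
  split.
  + by move=> W W'; rewrite !tildeE.
  + have Lonto k := @m_accretive_shift_onto R H dot D L k dotE Llin Lmacc.
    have Blin := Btilde_step_linear alpha c tau Llin.
    have Bonto := Btilde_step_onto alpha_gt0 c_gt0 tau_gt0 Lonto.
    (* A vector in the kernel of [I + tau B] has product norm at most [0]. *)
    have [|J JP] := linear_operator_inverse Blin _ Bonto.
      move=> [u v] /= Du Bw0; have := expansive (u, v) Du; rewrite Bw0.
      rewrite /prod_norm/= /hnorm normr0 expr0n addr0 sqrtr0 => norm_le0.
      have : `|u| ^+ 2 + `|v| ^+ 2 == 0.
        rewrite eq_le addr_ge0 ?sqr_ge0// andbT -sqrtr_eq0.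
        by rewrite eq_le norm_le0 sqrtr_ge0.
      rewrite paddr_eq0 ?sqr_ge0// !sqrf_eq0 !normr_eq0.
      by move=> /andP[/eqP-> /eqP->].
    exists J; split=> // f; have [JK _] := JP; have [DJ {2}<-] := JK f.
    exact: expansive.
  + move=> W F Wt Ft scheme n n_ge1.
    have [DW /(congr1 ( *:%R tau))] := scheme n n_ge1.
    rewrite scalerDr scalerA mulfV ?gt_eqF// scale1r.
    move=> /(congr1 (+%R (Wt n.-1))); rewrite addrA subrKC => step.
    have {}step : Wt n + tau *: B (Wt n) = Wt n.-1 + (tau *: Ft n, 0).
      by rewrite step; congr (_ + (_, _)); rewrite /= scaler0.
    have bound :
        prod_norm hnorm (Wt n) <= prod_norm hnorm (Wt n.-1) + tau * hnorm (Ft n).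
      rewrite (le_trans (expansive _ DW))// step.
      rewrite (le_trans (prod_normD_left _ _))//.
      by rewrite normrZ gtr0_norm.
    split=> // Fn0; rewrite -!tildeE.
    suff : prod_norm hnorm (Wt n) <= prod_norm hnorm (Wt n.-1) by [].
    by move: bound; rewrite /Ft Fn0 scaler0 /hnorm normr0 mulr0 addr0.
- move=> N L M S [Lacc _] Mpd Ssqrt cnorm pnorm.
  have cnormE W : cnorm (S *m W) = pnorm (S *m tilde_h c W).
    rewrite /cnorm /pnorm weighted_norm_components ?ltW//.
    rewrite !tilde_hE !mulmxA; congr (prod_norm _ (components (_ *m _))).
    have [Spd SS] := Ssqrt; apply: commute_posdef_sqrt => //; rewrite SS.
    rewrite /calM !mulmx_block !(mulmx0, mul0mx, addr0, add0r, mul1mx, mulmx1).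
    by rewrite mul_scalar_mx mul_mx_scalar.
  split=> [W W'|W scheme n n_ge1]; first by rewrite !cnormE.
  suff le_p : pnorm (S *m tilde_h c (W n)) <= pnorm (S *m tilde_h c (W n.-1)).
    by rewrite !cnormE.
  rewrite /pnorm !prod_norm_components ler_wsqrtr//.
  by apply: le_semidiscrete_step Lacc Ssqrt (scheme n n_ge1) => //; exact: ltW.
Qed.
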